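(* The subriemannian manifolds $\mathbb{S}^7_Q$ and $\mathbb{S}^7_T$ are not locally isometric. Furthermore, the isometry group $\mathcal{I}(\mathbb{S}^7_T)$ of the trivializable subriemannian structure does not act transitively on $\mathbb{S}^7$.
   Context: Let $\mathbb{S}^7\subset\mathbb{R}^4\times\mathbb{R}^4\cong\mathbb{H}^2$ be the unit sphere with the standard Riemannian metric. $\mathbb{S}^7_Q$ (quaternionic contact structure): $\mathbb{S}^7$ with the rank $4$ distribution $\mathcal{H}_Q$ given by the orthogonal complement in $T\mathbb{S}^7$ of the span of the vector fields $q\mapsto q{\bf i},\ q\mapsto q{\bf j},\ q\mapsto q{\bf k}$ (right multiplication), and fiber inner product the restriction of the standard metric. $\mathbb{S}^7_T$ (trivializable structure): $\mathbb{S}^7$ with the rank $4$ distribution $\mathcal{H}_T=\mathrm{Span}\{X_1,\dots,X_4\}$, $X_l(z)=A_lz$, where $$A_1(x,y)=(y{\bf k},x{\bf k}),\quad A_2(x,y)=(y{\bf j},x{\bf j}),\quad A_3(x,y)=(-y{\bf i},-x{\bf i}),\quad A_4(x,y)=(y,-x),$$ and fiber inner product the restriction of the standard metric. Both distributions are bracket generating of step two. A (local) subriemannian isometry $\phi:(M,\mathcal{H},\langle\cdot,\cdot\rangle)\to(M',\mathcal{H}',\langle\cdot,\cdot\rangle')$ is a (local) diffeomorphism with $\phi_*(\mathcal{H})\subseteq\mathcal{H}'$ such that $\phi_*:\mathcal{H}\to\mathcal{H}'$ is a fiberwise isometry. Two subriemannian manifolds are called locally isometric if every point of either of them has an open neighbourhood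 which is subriemannian isometric (as a manifold with the restricted structure) to an open subset of the other. $\mathcal{I}(\mathbb{S}^7_T)$ is the group of all subriemannian isometries $\mathbb{S}^7_T\to\mathbb{S}^7_T$. *)

(* Defs.v *)
From HB Require Import structures.
From mathcomp Require Import all_boot all_order all_algebra.
From mathcomp Require Import all_classical all_reals all_analysis.

Set Implicit Arguments.
Unset Strict Implicit.
Unset Printing Implicit Defensive.

Import Order.TTheory GRing.Theory Num.Theory.
Import numFieldNormedType.Exports.

Local Open Scope classical_set_scope.
Local Open Scope ring_scope.

Section Quaternions.
Variable R : realType.

(* Hamilton quaternions: the row (a, b, c, d) stands for a + bi + cj + dk. *)
Definition quat := 'rV[R]_4.

Definition mkquat (a b c d : R) : quat := \row_(n < 4) [:: a; b; c; d]`_n.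

Definition qmul (x y : quat) : quat :=
  let a := x 0 (inord 0) in let b := x 0 (inord 1) in
  let c := x 0 (inord 2) in let d := x 0 (inord 3) in
  let a' := y 0 (inord 0) in let b' := y 0 (inord 1) in
  let c' := y 0 (inord 2) in let d' := y 0 (inord 3) in
  mkquat (a * a' - b * b' - c * c' - d * d')
         (a * b' + b * a' + c * d' - d * c')
         (a * c' - b * d' + c * a' + d * b')
         (a * d' + b * c' - c * b' + d * a').

Definition qi : quat := mkquat 0 1 0 0.
Definition qj : quat := mkquat 0 0 1 0.
Definition qk : quat := mkquat 0 0 0 1.

End Quaternions.

Section SphereGeometry.
Variable R : realType.

(* R^4 x R^4 = H^2; the pair (x, y) is [row_mx x y].  The library norm on
   this type is the sup norm: it is only used through the topology, and the
   Euclidean structure is [dot]. *)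
Definition E8 := 'rV[R]_(4 + 4).

Definition dot (u v : E8) : R := (u *m v^T) 0 0.

Definition sphere7 : set E8 := [set z | dot z z = 1].

Definition open_in_sphere7 (U : set E8) : Prop :=
  exists2 O : set E8, open O & U = sphere7 `&` O.

(* C^k on an open set W, by iterated directional derivatives. *)
Fixpoint Ck (k : nat) (W : set E8) (F : E8 -> E8) : Prop :=
  if k is k'.+1 then
    forall v : E8,
      (forall x, W x -> derivable F x v) /\ Ck k' W (fun x => 'D_v F x)
  else forall x, W x -> {for x, continuous F}.

Definition smooth_on (W : set E8) (F : E8 -> E8) : Prop :=
  forall k, Ck k W F.

(* F extends f smoothly from a neighbourhood of p in U to a neighbourhood of p
   in the ambient space. *)
Definition local_extension (U : set E8) (f : E8 -> E8) (p : E8)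
    (F : E8 -> E8) : Prop :=
  exists W : set E8, [/\ open W, W p, smooth_on W F &
    forall x, W x -> U x -> F x = f x].

(* Maps between subsets of the sphere are total functions of which only the
   restriction to the relevant subset matters. *)
Definition smooth_map (U : set E8) (f : E8 -> E8) : Prop :=
  forall p, U p -> exists F, local_extension U f p F.

Definition diffeo (U V : set E8) (f : E8 -> E8) : Prop :=
  smooth_map U f /\
  exists g : E8 -> E8, smooth_map V g /\
    [/\ set_fun U V f, set_fun V U g,
        forall x, U x -> g (f x) = x & forall y, V y -> f (g y) = y].

(* A distribution on the sphere: H p is the fiber at p.  Every fiber carries
   the inner product [dot]. *)
Definition distribution := E8 -> set E8.

(* For U open in the sphere, the differential of f at p is the restriction to
   the tangent space of v |-> 'D_v F p, for any local smooth extension F of f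
   at p (existence is part of [diffeo]; the choice of F is irrelevant). *)
Definition subriemannian_isometry (H H' : distribution) (U V : set E8)
    (f : E8 -> E8) : Prop :=
  diffeo U V f /\
  forall p, U p -> forall F, local_extension U f p F ->
    (forall v, H p v -> H' (f p) ('D_v F p)) /\
    (forall v w, H p v -> H p w -> dot ('D_v F p) ('D_w F p) = dot v w).

Definition locally_isometric_into (H H' : distribution) : Prop :=
  forall p, sphere7 p -> exists (U V : set E8) (f : E8 -> E8),
    [/\ open_in_sphere7 U, U p, open_in_sphere7 V &
        subriemannian_isometry H H' U V f].

Definition locally_isometric (H H' : distribution) : Prop :=
  locally_isometric_into H H' /\ locally_isometric_into H' H.

Definition isometry_group (H : distribution) : set (E8 -> E8) :=
  [set f | subriemannian_isometry H H sphere7 sphere7 f].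

Definition acts_transitively_on_sphere7 (G : set (E8 -> E8)) : Prop :=
  forall p q, sphere7 p -> sphere7 q -> exists2 f, G f & f p = q.

Definition qrmul (z : E8) (q : quat R) : E8 :=
  row_mx (qmul (lsubmx z) q) (qmul (rsubmx z) q).

Definition HQ : distribution := fun p =>
  [set v | [/\ dot v p = 0, dot v (qrmul p (qi R)) = 0,
               dot v (qrmul p (qj R)) = 0 & dot v (qrmul p (qk R)) = 0]].

Definition A1 (z : E8) : E8 :=
  row_mx (qmul (rsubmx z) (qk R)) (qmul (lsubmx z) (qk R)).
Definition A2 (z : E8) : E8 :=
  row_mx (qmul (rsubmx z) (qj R)) (qmul (lsubmx z) (qj R)).
Definition A3 (z : E8) : E8 :=
  row_mx (- qmul (rsubmx z) (qi R)) (- qmul (lsubmx z) (qi R)).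
Definition A4 (z : E8) : E8 :=
  row_mx (rsubmx z) (- lsubmx z).

Definition HT : distribution := fun p =>
  [set v | exists c1 c2 c3 c4 : R,
     v = c1 *: A1 p + c2 *: A2 p + c3 *: A3 p + c4 *: A4 p].

End SphereGeometry.

(* Main.v *)
(* The invariant that separates the structures is fatness: a step-two
   distribution H is fat at p when, for every nonzero v in H_p, brackets with v
   fill TM/H.  On forms: if nu is conormal to H' along the target, then
   z |-> <D F (A_l z), nu (F z)> vanishes on the sphere for every local isometry
   F from HT to H'.  Differentiating this along A_m z, exchanging l and m and
   using the symmetry of the second derivative of F gives
     <D F ([A_l, A_m] p), nu> + <w_l, D nu w_m> - <w_m, D nu w_l> = 0
   up to sign, where w_l = D F (A_l p).  At the diagonal point p = (1, 1) / sqrt 2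
   both A_1 A_2 p and A_2 A_1 p are multiples of A_3 p, hence horizontal, so the
   first term drops: HT is not fat at p, and in the target w_1, w_2 are
   orthonormal vectors of H' on which the curvature of every conormal nu vanishes.
   This is impossible in HQ, where w_2 would be orthogonal to the orthonormal
   basis q, qi, qj, qk, w_1, w_1 i, w_1 j, w_1 k, and also in HT at (1, 0), where
   the curvature forms are the left multiplications by i, j, k. *)
From HB Require Import structures.
Require Import Defs.
From mathcomp Require Import all_boot all_order all_algebra.
From mathcomp Require Import all_classical all_reals all_analysis.
From mathcomp Require Import ring lra.

Set Implicit Arguments.
Unset Strict Implicit.
Unset Printing Implicit Defensive.

Import Order.TTheory GRing.Theory Num.Theory.
Import numFieldNormedType.Exports.

Local Open Scope classical_set_scope.
Local Open Scope ring_scope.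

(** * Directional derivatives *)

Section DirectionalDerivatives.
Variable R : realType.

Lemma ler_dist2_half (a b c d e : R) :
  `|a - b| <= e / 2 -> `|c - d| <= e / 2 -> b = d -> `|a - c| <= e.
Proof.
move=> ab; rewrite distrC => cd bd; rewrite -bd in cd.
have := lerD ab cd; rewrite -splitr; apply: le_trans.
exact: ler_distD.
Qed.

Lemma ler_entry_norm (m n : nat) (M : 'M[R]_(m, n)) i j : `|M i j| <= `|M|.
Proof.
rewrite [leRHS]/Num.Def.normr/= mx_normrE.
exact: (le_bigmax _ (fun k : 'I_m * 'I_n => `|M k.1 k.2|) (i, j)).
Qed.

Section General.
Variable V : normedModType R.

(** The two difference quotients coincide, which brings the one-variable mean value theorem and
    chain rule to directional derivatives. *)
Lemma is_derive_line (W : normedModType R) (F : V -> W) (x v : V) (t : R) :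
  derivable F (t *: v + x) v ->
  is_derive t 1 (fun h : R => F (h *: v + x)) ('D_v F (t *: v + x)).
Proof.
have E : (fun h : R => h^-1 *: (((fun k : R => F (k *: v + x)) \o shift t) (h *: 1)
            - F (t *: v + x))) =
         (fun h : R => h^-1 *: ((F \o shift (t *: v + x)) (h *: v)
            - F (t *: v + x))).
  by apply/funext => h /=; rewrite [h *: 1]mulr1 scalerDl addrA.
move=> dF; apply: DeriveDef.
  by rewrite /derivable E; exact: dF.
by rewrite /derive E.
Qed.

Lemma growth_rate_translate (W : normedModType R) (F : V -> W) (a x v : V) :
  (fun h : R => h^-1 *: (((fun y => F (a + y)) \o shift x) (h *: v) - F (a + x)))
  = (fun h : R => h^-1 *: ((F \o shift (a + x)) (h *: v) - F (a + x))).
Proof. by apply/funext => h /=; rewrite addrCA. Qed.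

Lemma derive_translate (W : normedModType R) (F : V -> W) (a x v : V) :
  'D_v (fun y => F (a + y)) x = 'D_v F (a + x).
Proof. by rewrite /derive growth_rate_translate. Qed.

Lemma derivable_translate (W : normedModType R) (F : V -> W) (a x v : V) :
  derivable F (a + x) v -> derivable (fun y => F (a + y)) x v.
Proof. by rewrite /derivable growth_rate_translate. Qed.

Lemma derive_scale_dir (W : normedModType R) (F : V -> W) (x v : V) (k : R) :
  derivable F x v -> 'D_(k *: v) F x = k *: 'D_v F x.
Proof.
move=> dF.
have dl : is_derive (0 * k) 1 (fun h : R => F (h *: v + x)) ('D_v F x).
  have E0 : 0 *: v + x = x by rewrite scale0r add0r.
  by rewrite mul0r; have := @is_derive_line _ F x v 0; rewrite E0; exact.
have d1 : differentiable (fun h : R => F (h *: v + x)) (0 * k).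
  by apply/derivable1_diffP; exact: ex_derive.
have -> : 'D_(k *: v) F x = 'D_1 ((fun h : R => F (h *: v + x)) \o *%R^~ k) 0.
  rewrite /derive; set g1 := fun h => h^-1 *: _; set g2 := fun h => h^-1 *: _.
  suff -> : g1 = g2 by [].
  rewrite /g1 /g2; apply/funext => h /=.
  by rewrite addr0 mul0r scale0r add0r [h *: 1]mulr1 scalerA.
rewrite deriveE; last exact: differentiable_comp.
rewrite diff_comp //= diff_val.
have -> : 1 *: k = k *: (1 : R) by rewrite scale1r [RHS]mulr1.
by rewrite linearZ -deriveE // derive_val.
Qed.

Lemma differentiable_linear_approx (W : normedModType R) (F : V -> W)
    (L : {linear V -> W}) (p : V) : continuous L ->
  (forall e : R, 0 < e ->
     \forall h \near (0 : V), `|F (h + p) - (F p + L h)| <= e * `|h|) ->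
  differentiable F p.
Proof.
move=> cL FL; suff oL : F \o shift p = cst (F p) + L +o_ (0 : V) id.
  by apply/diff_locallyP; rewrite (diff_unique cL oL).
by apply/eqaddoP => _/posnumP[e]; exact: FL.
Qed.

(** Mean value arguments yield intermediate points at unknown places of a small parallelogram; a
    single step [h] must keep all of them in the neighbourhood. *)
Lemma near_parallelogram (P : V -> Prop) (p v w : V) :
  (\forall x \near p, P x) ->
  \forall h \near (0 : R)^'+, forall s t : R, 0 <= s <= h -> 0 <= t <= h ->
    P (s *: v + (t *: w + p)).
Proof.
move=> /nbhs_ballP[e /= e0 eP].
have M0 : 0 < `|v| + `|w| + 1 by rewrite ltr_wpDl // addr_ge0.
near=> h => s t /andP[s0 sh] /andP[t0 th]; apply: eP.
rewrite -ball_normE /ball_ /= addrA opprD addrCA subrr addr0 normrN.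
apply: (le_lt_trans (ler_normD _ _)); rewrite !normrZ !ger0_norm //.
have h0 : 0 <= h by exact: le_trans sh.
apply: (@le_lt_trans _ _ (h * (`|v| + `|w| + 1))).
  have := normr_ge0 v; have := normr_ge0 w; nra.
rewrite -ltr_pdivlMr //.
near: h; apply: nbhs_right_lt; exact: divr_gt0.
Unshelve. all: by end_near. Qed.

End General.

(** * Mean values, symmetry of second derivatives, additivity in the direction *)

Section RowValued.
Variables (V : normedModType R) (m : nat).
Implicit Types (F : V -> 'rV[R]_m) (x v w : V).

(** Stated for one coordinate at a time because the intermediate point depends on [j]. *)
Lemma MVT_line F x v (h : R) (j : 'I_m) : 0 <= h ->
  (forall t : R, 0 <= t <= h -> derivable F (t *: v + x) v) ->
  exists2 t : R, 0 <= t <= h &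
    F (h *: v + x) 0 j - F x 0 j = h * 'D_v F (t *: v + x) 0 j.
Proof.
move=> h0 dF.
have dFj t : 0 <= t <= h -> is_derive t 1 (fun k : R => F (k *: v + x) 0 j)
                              ('D_v F (t *: v + x) 0 j).
  move=> th; have dt := dF t th.
  have := is_derive_line ((derivable_mxP _ _ _).1 dt 0 j).
  by rewrite derive_mx// mxE.
have dFo t : t \in `]0, h[%R -> is_derive t 1 (fun k : R => F (k *: v + x) 0 j)
                                  ('D_v F (t *: v + x) 0 j).
  by rewrite in_itv /= => /andP[/ltW t0 /ltW th]; apply: dFj; rewrite t0.
have [|c ch] := MVT_segment h0 dFo.
  apply: derivable_within_continuous => t; rewrite in_itv => th.
  by have [] := dFj t th.
rewrite subr0 scale0r add0r => E.
by exists c => //; rewrite E mulrC.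
Qed.

(* The left-hand side is symmetric in v and w, hence [derive_comm]. *)
Lemma second_difference F p v w (h : R) (j : 'I_m) : 0 <= h ->
  (forall s t : R, 0 <= s <= h -> 0 <= t <= h ->
     derivable F (t *: w + (s *: v + p)) v /\
     derivable ('D_v F) (t *: w + (s *: v + p)) w) ->
  exists s t : R, [/\ 0 <= s <= h, 0 <= t <= h &
    F (h *: w + (h *: v + p)) 0 j - F (h *: v + p) 0 j
      - (F (h *: w + p) 0 j - F p 0 j) =
    h * (h * 'D_w ('D_v F) (t *: w + (s *: v + p)) 0 j)].
Proof.
move=> h0 dF.
have hh : 0 <= h <= h by rewrite h0 lexx.
have h00 : 0 <= (0 : R) <= h by rewrite lexx h0.
have d1 (s : R) : 0 <= s <= h -> derivable (fun x => F (h *: w + x)) (s *: v + p) v.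
  move=> sh; apply: derivable_translate; exact: (dF s h sh hh).1.
have d2 (s : R) : 0 <= s <= h -> derivable F (s *: v + p) v.
  move=> sh; have := (dF s 0 sh h00).1; rewrite scale0r add0r; exact.
(* The mean value theorem is used along [v] for the increment of [F] by [h *: w], then along [w] for
   ['D_v F]. *)
have [s sh] := @MVT_line (fun x => F (h *: w + x) - F x) p v h j h0
  (fun s sh => derivableB (d1 s sh) (d2 s sh)).
rewrite (deriveB (d1 s sh) (d2 s sh)) derive_translate !mxE => E1.
have [t th E2] := @MVT_line ('D_v F) (s *: v + p) w h j h0
  (fun t th => (dF s t sh th).2).
by exists s, t; split=> //; rewrite E1 E2.
Qed.

(** Schwarz's theorem: at suitable points of a small parallelogram both mixed derivatives equal the
    same second difference divided by [h ^+ 2], and continuity at [p] carries the equality to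
    [p]. *)
Lemma derive_comm F p v w (A : set V) : open A -> A p ->
  (forall x, A x -> [/\ derivable F x v, derivable F x w,
     derivable ('D_v F) x w & derivable ('D_w F) x v]) ->
  {for p, continuous ('D_w ('D_v F))} -> {for p, continuous ('D_v ('D_w F))} ->
  'D_w ('D_v F) p = 'D_v ('D_w F) p.
Proof.
move=> oA Ap dF c1 c2; apply/rowP => j; apply/eqP; rewrite -subr_eq0 -normr_le0.
apply/ler_addgt0Pl => e e0; rewrite addr0.
have cj (G : V -> 'rV[R]_m) : {for p, continuous G} ->
    \forall x \near p, `|G p 0 j - G x 0 j| <= e / 2.
  move=> cG; apply: (@cvgr_dist_le _ _ _ _ _ (fun x => G x 0 j)); last exact: divr_gt0.
  exact: (continuous_comp cG (@coord_continuous _ _ _ _ _ _)).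
have nA : \forall x \near p, A x by exact: open_nbhs_nbhs.
have nQ : \forall x \near p, A x /\
    (`|'D_w ('D_v F) p 0 j - 'D_w ('D_v F) x 0 j| <= e / 2 /\
     `|'D_v ('D_w F) p 0 j - 'D_v ('D_w F) x 0 j| <= e / 2).
  apply: filterI; first exact: nA.
  by apply: filterI; [exact: (cj _ c1)|exact: (cj _ c2)].
have nP := near_parallelogram v w nQ.
have [h [h0 hP]] := filter_ex (filterI (nbhs_right_gt (0 : R)) nP).
have Avw s t : 0 <= s <= h -> 0 <= t <= h -> A (s *: v + (t *: w + p)).
  by move=> sh th; case: (hP s t sh th).
have Awv s t : 0 <= s <= h -> 0 <= t <= h -> A (t *: w + (s *: v + p)).
  by rewrite addrCA; exact: Avw.
have [|s [t [sh th E1]]] := @second_difference F p v w h j (ltW h0).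
  by move=> s t sh th; case: (dF _ (Awv s t sh th)) => a _ c _; exact: conj a c.
have [|t' [s' [th' sh' E2]]] := @second_difference F p w v h j (ltW h0).
  by move=> t' s' th' sh'; case: (dF _ (Avw s' t' sh' th')) => _ b _ d; exact: conj b d.
have E : 'D_w ('D_v F) (t *: w + (s *: v + p)) 0 j =
         'D_v ('D_w F) (s' *: v + (t' *: w + p)) 0 j.
  apply: (mulfI (lt0r_neq0 h0)); apply: (mulfI (lt0r_neq0 h0)).
  apply: etrans (esym E1) _; apply: etrans _ E2.
  rewrite (addrCA (h *: v)) !opprB addrACA [RHS]addrACA.
  by congr (_ + _); exact: addrC.
have [_ [B1 _]] := hP s t sh th.
have [_ [_ B2]] := hP s' t' sh' th'.
rewrite (addrCA (s *: v)) in B1.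
exact: ler_dist2_half B1 B2 E.
Qed.

(** The quotient along [v + w] minus the one along [v] is a quotient along [w] based at
    [h *: v + p]; the mean value theorem and the continuity of ['D_w F] at [p] give its limit. *)
Lemma derive_add_dir F p v w (A : set V) : open A -> A p ->
  (forall u x, A x -> derivable F x u) -> {for p, continuous ('D_w F)} ->
  'D_(v + w) F p = 'D_v F p + 'D_w F p.
Proof.
move=> oA Ap dF cw; apply/rowP => j; rewrite mxE addrC; apply/eqP.
rewrite -subr_eq; apply/eqP.
pose G u (h : R) : R := h^-1 *: (F (h *: u + p) 0 j - F p 0 j).
(* The two-sided limits exist by derivability, so limits from the right determine them; this fits
   the positive steps of [near_parallelogram]. *)
have cvG u : G u h @[h --> 0^'+] --> 'D_u F p 0 j.
  apply: (cvg_dnbhs_at_right (f := G u)).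
  rewrite (derive_mx (dF u p Ap)) mxE.
  exact: ((derivable_mxP _ _ _).1 (dF u p Ap) 0 j).
have cvB : (G (v + w) h - G v h) @[h --> (0 : R)^'+] -->
    'D_(v + w) F p 0 j - 'D_v F p 0 j by exact: cvgB (cvG _) (cvG _).
suff cvD : (G (v + w) h - G v h) @[h --> (0 : R)^'+] --> 'D_w F p 0 j.
  exact: norm_cvg_unique cvB cvD.
apply/cvgrPdist_le => e e0.
have cwj : \forall x \near p, `|'D_w F p 0 j - 'D_w F x 0 j| <= e.
  apply: (@cvgr_dist_le _ _ _ _ _ (fun x => 'D_w F x 0 j)) => //.
  exact: (continuous_comp cw (@coord_continuous _ _ _ _ _ _)).
have nQ : \forall x \near p, A x /\ `|'D_w F p 0 j - 'D_w F x 0 j| <= e.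
  by apply: filterI; [exact: open_nbhs_nbhs|exact: cwj].
have nP := near_parallelogram v w nQ.
apply: filterS2 (nbhs_right_gt (0 : R)) nP => h h0 hP.
have hh : 0 <= h <= h by rewrite lexx ltW.
have [t th|t th E] := @MVT_line F (h *: v + p) w h j (ltW h0).
  by rewrite (addrCA (t *: w)); apply: dF; case: (hP h t hh th).
have [_ hPt] := hP h t hh th; rewrite (addrCA (h *: v)) in hPt.
suff -> : G (v + w) h - G v h = 'D_w F (t *: w + (h *: v + p)) 0 j by [].
have -> : G (v + w) h - G v h =
    h^-1 * (F (h *: w + (h *: v + p)) 0 j - F (h *: v + p) 0 j).
  rewrite /G -mulrBr; congr (_ * _); rewrite (addrC v) scalerDr addrA.
  by rewrite opprB addrA subrK.
by rewrite E mulKf // lt0r_neq0.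
Qed.

End RowValued.

(** * From continuous directional derivatives to differentiability *)

Section FiniteDimension.
Variables (n m : nat).
Implicit Types (F : 'rV[R]_n -> 'rV[R]_m) (x v w : 'rV[R]_n).

(** Reduces a derivative in a varying direction to finitely many fixed directions, as
    [pullback_derivative] requires. *)
Lemma derive_dir_sum F (A : set 'rV[R]_n) x v : open A -> A x ->
  (forall u y, A y -> derivable F y u) ->
  (forall u y, A y -> {for y, continuous ('D_u F)}) ->
  'D_v F x = \sum_(i < n) v 0 i *: 'D_(delta_mx 0 i) F x.
Proof.
move=> oA Ax dF cF; rewrite [in LHS](row_sum_delta v).
elim/big_rec2: _ => [|i y z _ <-]; first exact: derive0.
rewrite (@derive_add_dir _ _ F x _ _ A oA Ax dF (cF _ _ Ax)).
by rewrite (derive_scale_dir _ (dF _ _ Ax)).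
Qed.

(** Links [Ck], phrased with directional derivatives, to the differentiability that the chain rule
    asks for. The mean value theorem on the segment from [p] to [h + p] bounds the error by [|h|]
    times the variation [S] of the partial derivatives. *)
Lemma C1_differentiable F (A : set 'rV[R]_n) p : open A -> A p ->
  (forall u x, A x -> derivable F x u) ->
  (forall u x, A x -> {for x, continuous ('D_u F)}) ->
  differentiable F p.
Proof.
move=> oA Ap dF cF.
pose L (u : 'rV[R]_n) := \sum_(i < n) u 0 i *: 'D_(delta_mx 0 i) F p.
have linL : linear L.
  move=> a u v; rewrite /L scaler_sumr -big_split; apply: eq_bigr => i _ /=.
  by rewrite !mxE scalerDl scalerA.
pose LM := GRing.isLinear.Build _ _ _ _ _ linL.
pose LL : {linear _ -> _} := HB.pack L LM.
have cL : continuous L.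
  have -> : L = \sum_(i < n) (fun u : 'rV[R]_n => u 0 i *: 'D_(delta_mx 0 i) F p).
    by apply/funext => u; rewrite fct_sumE.
  move=> u; apply: differentiable_continuous; apply: differentiable_sum => i.
  by apply: differentiableZl; exact: differentiable_coord.
apply: (@differentiable_linear_approx _ _ _ LL p cL) => e e0.
have nA : \forall x \near p, A x by exact: open_nbhs_nbhs.
pose S x := \sum_(i < n) `|'D_(delta_mx 0 i) F x - 'D_(delta_mx 0 i) F p|.
have nS : \forall x \near p, S x <= e.
  have cSi i : `|'D_(delta_mx 0 i) F x - 'D_(delta_mx 0 i) F p| @[x --> p]
      --> `|'D_(delta_mx 0 i) F p - 'D_(delta_mx 0 i) F p|.
    have cFi : 'D_(delta_mx 0 i) F x @[x --> p] --> 'D_(delta_mx 0 i) F p := cF _ p Ap.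
    exact: (cvg_norm (cvgB cFi (cvg_cst _))).
  have cS : S x @[x --> p] --> S p.
    exact: (@cvg_big _ _ _ _ predT add_continuous _ (nbhs p) _ _ _ (nbhs_filter p)
      (fun i _ => cSi i)).
  have S0 : S p = 0 by rewrite /S big1 // => i _; rewrite subrr normr0.
  have := @cvgr_le _ _ _ _ _ _ cS e; rewrite S0; exact.
have /nbhs_ballP[d /= d0 dP] : \forall x \near p, A x /\ S x <= e.
  by apply: filterI.
have dN : \forall h \near (0 : 'rV[R]_n), `|h| < d by exact: nbhs0_lt.
apply: filterS dN => h hd0.
have hd (t : R) : 0 <= t <= 1 -> ball p d (t *: h + p).
  move=> /andP[t0 t1]; rewrite -ball_normE /ball_ /= opprD addrCA subrr addr0.
  rewrite normrN normrZ ger0_norm //; apply: le_lt_trans hd0.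
  by rewrite ler_piMl.
rewrite [leLHS]/Num.Def.normr/= mx_normrE.
apply: bigmax_le => [|[a j] _] /=; first by rewrite mulr_ge0 // ltW.
rewrite !mxE ord1.
have [|t t01] := @MVT_line _ _ F p h 1 j ler01.
  by move=> t t01; apply: dF; apply: (dP _ _).1; exact: hd.
rewrite scale1r mul1r opprD addrA => ->.
have [At St] := dP _ (hd t t01).
rewrite (derive_dir_sum _ oA At dF cF) /L !summxE -sumrB.
apply: (le_trans (ler_norm_sum _ _ _)).
apply: (@le_trans _ _ (S (t *: h + p) * `|h|)); last by rewrite ler_wpM2r.
rewrite mulr_suml; apply: ler_sum => i _.
rewrite 2!mxE -mulrBr normrM mulrC; apply: ler_pM => //; last exact: ler_entry_norm.
have := ler_entry_norm ('D_(delta_mx 0 i) F (t *: h + p) - 'D_(delta_mx 0 i) F p) 0 j.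
by rewrite mxE [X in _ + X]mxE; exact.
Qed.

End FiniteDimension.
End DirectionalDerivatives.

(** * The derivative of a pulled back conormal field *)

Section Curves.
Variable R : realType.

Lemma is_derive_coord (V : normedModType R) (m n : nat) (M : V -> 'M[R]_(m, n))
    (x v : V) (d : 'M[R]_(m, n)) i j :
  is_derive x v M d -> is_derive x v (fun y => M y i j) (d i j).
Proof.
move=> [dM <-]; apply: DeriveDef; first exact: ((derivable_mxP _ _ _).1 dM i j).
by rewrite (derive_mx dM) mxE.
Qed.

Lemma is_derive_mx (V : normedModType R) (m n : nat) (M : V -> 'M[R]_(m, n))
    (x v : V) (d : 'M[R]_(m, n)) :
  (forall i j, is_derive x v (fun y => M y i j) (d i j)) -> is_derive x v M d.
Proof.
move=> dM; have dM' : derivable M x v.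
  by apply/derivable_mxP => i j; case: (dM i j).
apply: DeriveDef => //; rewrite (derive_mx dM').
by apply/matrixP => i j; rewrite mxE; case: (dM i j).
Qed.

Lemma is_derive_comp_curve (V W : normedModType R) (G : V -> W) (c : R -> V)
    (t : R) (v : V) :
  differentiable G (c t) -> is_derive t 1 c v ->
  is_derive t 1 (G \o c) ('D_v G (c t)).
Proof.
move=> dG [/derivable1_diffP dc dcE].
apply: DeriveDef; first by apply/derivable1_diffP; exact: differentiable_comp.
rewrite deriveE; last exact: differentiable_comp.
by rewrite diff_comp //= -dcE [in RHS]deriveE // deriveE.
Qed.

Lemma is_derive_sum_fun (V : normedModType R) n (h : 'I_n -> V -> R) (dh : 'I_n -> R)
    (x v : V) : (forall i, is_derive x v (h i) (dh i)) ->
  is_derive x v (fun t => \sum_(i < n) h i t) (\sum_(i < n) dh i).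
Proof.
move=> dhi; rewrite (_ : (fun _ => _) = \sum_(i < n) h i); first exact: is_derive_sum.
by apply/funext => t; rewrite fct_sumE.
Qed.

Lemma is_derive_mul_fun (V : normedModType R) (f g : V -> R) (x v : V) (df dg : R) :
  is_derive x v f df -> is_derive x v g dg ->
  is_derive x v (fun t => f t * g t) (f x * dg + df * g x).
Proof.
move=> dfx dgx; rewrite (_ : (fun _ => _) = f * g) //.
by apply: is_derive_eq; rewrite /GRing.scale /= [g x * _]mulrC.
Qed.

(** For orthonormal [p] and [v] this is the great circle through [p] with velocity [v]. It stays on
    the sphere, where the pairing with a conormal field is known to vanish. *)
Definition circle n (p v : 'rV[R]_n) (t : R) : 'rV[R]_n :=
  cos t *: p + sin t *: v.

Lemma circle0 n (p v : 'rV[R]_n) : circle p v 0 = p.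
Proof. by rewrite /circle cos0 sin0 scale1r scale0r addr0. Qed.

Lemma is_derive_circle n (p v : 'rV[R]_n) : is_derive (0 : R) 1 (circle p v) v.
Proof.
apply: is_derive_mx => i j.
have -> : (fun t => circle p v t i j) = (fun t => cos t * p i j + sin t * v i j).
  by apply/funext => t; rewrite !mxE.
apply: is_derive_eq.
by rewrite sin0 cos0 /GRing.scale /=; ring.
Qed.

End Curves.

Section Dot.
Variable R : realType.
Implicit Types u v w : E8 R.

Lemma dotE u v : dot u v = \sum_j u 0 j * v 0 j.
Proof. by rewrite /dot mxE; apply: eq_bigr => j _; rewrite mxE. Qed.

Lemma dotC u v : dot u v = dot v u.
Proof. by rewrite !dotE; apply: eq_bigr => j _; rewrite mulrC. Qed.

Lemma dotDl u v w : dot (u + v) w = dot u w + dot v w.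
Proof. by rewrite /dot mulmxDl mxE. Qed.

Lemma dotZl a u w : dot (a *: u) w = a * dot u w.
Proof. by rewrite /dot -scalemxAl mxE. Qed.

Lemma dotDr u v w : dot w (u + v) = dot w u + dot w v.
Proof. by rewrite ![dot w _]dotC dotDl. Qed.

Lemma dotZr a u w : dot w (a *: u) = a * dot w u.
Proof. by rewrite ![dot w _]dotC dotZl. Qed.

Lemma circle_sphere7 u v t : dot u u = 1 -> dot v v = 1 -> dot u v = 0 ->
  sphere7 (circle u v t).
Proof.
move=> uu vv uv; rewrite /sphere7 /= /circle !(dotDl, dotDr, dotZl, dotZr).
rewrite [dot v u]dotC uu vv uv; have := cos2Dsin2 t; lra.
Qed.

End Dot.

Section Pullback.
Variable R : realType.
Local Notation E := (E8 R).

(** The pairing in the last hypothesis is differentiated at [p] along the great circle with velocity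
    [v]. The three terms come from varying the base point of the derivative of [F], the direction
    [A z], and the conormal field. *)
Lemma pullback_derivative (W O : set E) (F A nu : E -> E) (p v : E) :
  open W -> W p -> smooth_on W F -> open O -> O p ->
  (forall (a b : R) x y, A (a *: x + b *: y) = a *: A x + b *: A y) ->
  dot p p = 1 -> dot v v = 1 -> dot p v = 0 ->
  differentiable nu (F p) ->
  (forall z, W z -> O z -> sphere7 z -> dot ('D_(A z) F z) (nu (F z)) = 0) ->
  dot ('D_(A p) ('D_v F) p + 'D_(A v) F p) (nu (F p))
    + dot ('D_(A p) F p) ('D_('D_v F p) nu (F p)) = 0.
Proof.
move=> oW Wp sF oO Op linA pp vv pv dnu ann.
have dF u x : W x -> derivable F x u by exact: (sF 1%N u).1.
have cF u x : W x -> {for x, continuous ('D_u F)} by exact: (sF 1%N u).2.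
have ddF u w x : W x -> derivable ('D_u F) x w by exact: ((sF 2%N u).2 w).1.
have cdF u w x : W x -> {for x, continuous ('D_w ('D_u F))}.
  by exact: ((sF 2%N u).2 w).2.
pose c := circle p v.
have c0 : c 0 = p by exact: circle0.
have dc : is_derive (0 : R) 1 c v by exact: is_derive_circle.
have cA t : A (c t) = circle (A p) (A v) t by rewrite /c /circle linA.
(* The pairing along the circle, expanded over the standard basis so that each factor is a function
   of [t] alone with a known derivative. *)
pose Phi (t : R) := \sum_(j < 8)
  ((\sum_(i < 8) A (c t) 0 i * 'D_(delta_mx 0 i) F (c t) 0 j) * nu (F (c t)) 0 j).
have dFp : differentiable F p by exact: C1_differentiable oW Wp dF cF.
have dDFp u : differentiable ('D_u F) p.
  exact: C1_differentiable oW Wp (fun w => ddF u w) (fun w => cdF u w).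
have dcomp (G : E -> E) : differentiable G p ->
    is_derive (0 : R) 1 (G \o c) ('D_v G p).
  by move=> dG; have := @is_derive_comp_curve _ _ _ G c 0 v; rewrite c0; exact.
have dnuFc : is_derive (0 : R) 1 (nu \o (F \o c)) ('D_('D_v F p) nu (F p)).
  have := @is_derive_comp_curve _ _ _ nu (F \o c) 0 ('D_v F p).
  by rewrite /= c0; apply => //; exact: dcomp.
have dAc : is_derive (0 : R) 1 (A \o c) (A v).
  rewrite (_ : A \o c = circle (A p) (A v)); first exact: is_derive_circle.
  by apply/funext => t /=; rewrite cA.
have dPhi := is_derive_sum_fun (fun j => is_derive_mul_fun
  (is_derive_sum_fun (fun i => is_derive_mul_fun (is_derive_coord 0 i dAc)
     (is_derive_coord 0 j (dcomp _ (dDFp (delta_mx 0 i))))))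
  (is_derive_coord 0 j dnuFc)).
rewrite /= c0 in dPhi.
have Phi0 : \forall t \near (0 : R), Phi t = 0.
  have cc : c t @[t --> (0 : R)] --> p.
    rewrite -[X in _ --> X]c0; apply: differentiable_continuous.
    by apply/derivable1_diffP; case: dc.
  have nWO : \forall x \near p, W x /\ O x.
    by apply: filterI; exact: open_nbhs_nbhs.
  have ncWO : \forall t \near (0 : R), W (c t) /\ O (c t) by exact: (cc _ nWO).
  apply: filterS ncWO => t [Wt Ot].
  rewrite -(ann _ Wt Ot (circle_sphere7 t pp vv pv)) dotE; apply: eq_bigr => j _.
  rewrite (derive_dir_sum _ oW Wt dF cF) summxE; congr (_ * _).
  by apply: eq_bigr => i _; rewrite mxE.
(* Differentiating [Phi] puts [v] outermost in the second derivatives, whereas the statement has [v]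
   innermost. *)
have sym_dd i : 'D_(delta_mx 0 i) ('D_v F) p = 'D_v ('D_(delta_mx 0 i) F) p.
  apply: (derive_comm oW Wp _ (cdF _ _ _ Wp) (cdF _ _ _ Wp)) => x Wx.
  by split; [exact: (dF _ _ Wx)|exact: (dF _ _ Wx)|
    exact: (ddF _ _ _ Wx)|exact: (ddF _ _ _ Wx)].
have DApv : 'D_(A p) ('D_v F) p = \sum_(i < 8) A p 0 i *: 'D_v ('D_(delta_mx 0 i) F) p.
  apply: etrans (derive_dir_sum (A p) oW Wp (fun w => ddF v w) (fun w => cdF v w)) _.
  by apply: eq_bigr => i _; exact: (congr1 (fun u => A p 0 i *: u) (sym_dd i)).
have := @derive_val _ _ _ _ _ _ _ dPhi.
have -> : 'D_1 Phi 0 = 0 by rewrite (near_eq_derive _ Phi0) derive_cst.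
move=> H; rewrite DApv (derive_dir_sum (A v) oW Wp dF cF).
rewrite (derive_dir_sum (A p) oW Wp dF cF) {DApv Phi0}.
rewrite !dotE -big_split /= [RHS]H; apply: eq_bigr => j _.
rewrite addrC -big_split !summxE; congr (_ * _ + _ * _).
  by apply: eq_bigr => i _; rewrite mxE.
by apply: eq_bigr => i _; rewrite mxE [X in X + _]mxE [X in _ + X]mxE.
Qed.

End Pullback.

(** * Coordinates on H^2 *)

Section Quaternions.
Variable R : realType.
Local Notation E := (E8 R).

Lemma mkquatK (x : quat R) :
  x = mkquat (x 0 (inord 0)) (x 0 (inord 1)) (x 0 (inord 2)) (x 0 (inord 3)).
Proof.
apply/rowP => j; rewrite mxE.
case: j => [[|[|[|[|//]]]] lt_j] /=; congr (x 0 _); apply/val_inj;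
  by rewrite /= inordK.
Qed.

Lemma mkquatE (a b c d : R) :
  (mkquat a b c d 0 (inord 0) = a) * (mkquat a b c d 0 (inord 1) = b) *
  (mkquat a b c d 0 (inord 2) = c) * (mkquat a b c d 0 (inord 3) = d).
Proof. by do !split; rewrite mxE inordK. Qed.

Lemma mkquatD (a b c d a' b' c' d' : R) :
  mkquat a b c d + mkquat a' b' c' d' = mkquat (a + a') (b + b') (c + c') (d + d').
Proof. by apply/rowP; case=> [[|[|[|[|//]]]] ?]; rewrite !mxE. Qed.

Lemma mkquatZ (t a b c d : R) :
  t *: mkquat a b c d = mkquat (t * a) (t * b) (t * c) (t * d).
Proof. by apply/rowP; case=> [[|[|[|[|//]]]] ?]; rewrite !mxE. Qed.

Lemma mkquatN (a b c d : R) : - mkquat a b c d = mkquat (- a) (- b) (- c) (- d).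
Proof. by apply/rowP; case=> [[|[|[|[|//]]]] ?]; rewrite !mxE. Qed.

Definition mkE8 (a b c d a' b' c' d' : R) : E :=
  row_mx (mkquat a b c d) (mkquat a' b' c' d').

(** Applied through [elim] to expose the eight coordinates, after which identities on H^2 are left
    to [ring]. *)
Lemma mkE8_ind (P : E -> Prop) :
  (forall a b c d a' b' c' d', P (mkE8 a b c d a' b' c' d')) -> forall z, P z.
Proof.
move=> PE z; rewrite -[z]hsubmxK [lsubmx z]mkquatK [rsubmx z]mkquatK.
exact: PE.
Qed.

Lemma dot_mkE8 (a b c d e f g h a' b' c' d' e' f' g' h' : R) :
  dot (mkE8 a b c d e f g h) (mkE8 a' b' c' d' e' f' g' h') =
  a * a' + b * b' + c * c' + d * d' + e * e' + f * f' + g * g' + h * h'.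
Proof.
rewrite /dot /mkE8 tr_row_mx mul_row_col mxE !mxE !big_ord_recl !big_ord0 !mxE /=.
ring.
Qed.

Lemma mkE8D (a b c d e f g h a' b' c' d' e' f' g' h' : R) :
  mkE8 a b c d e f g h + mkE8 a' b' c' d' e' f' g' h' =
  mkE8 (a + a') (b + b') (c + c') (d + d') (e + e') (f + f') (g + g') (h + h').
Proof. by rewrite /mkE8 add_row_mx !mkquatD. Qed.

Lemma mkE8Z (t a b c d e f g h : R) :
  t *: mkE8 a b c d e f g h =
  mkE8 (t * a) (t * b) (t * c) (t * d) (t * e) (t * f) (t * g) (t * h).
Proof. by rewrite /mkE8 scale_row_mx !mkquatZ. Qed.

Lemma mkE8N (a b c d e f g h : R) :
  - mkE8 a b c d e f g h = mkE8 (- a) (- b) (- c) (- d) (- e) (- f) (- g) (- h).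
Proof. by rewrite /mkE8 opp_row_mx !mkquatN. Qed.

Lemma qmul_mkquat (a b c d a' b' c' d' : R) :
  qmul (mkquat a b c d) (mkquat a' b' c' d') =
  mkquat (a * a' - b * b' - c * c' - d * d')
         (a * b' + b * a' + c * d' - d * c')
         (a * c' - b * d' + c * a' + d * b')
         (a * d' + b * c' - c * b' + d * a').
Proof. by rewrite /qmul !mkquatE. Qed.

Lemma lsubmx_mkE8 (a b c d e f g h : R) :
  lsubmx (mkE8 a b c d e f g h) = mkquat a b c d.
Proof. exact: row_mxKl. Qed.

Lemma rsubmx_mkE8 (a b c d e f g h : R) :
  rsubmx (mkE8 a b c d e f g h) = mkquat e f g h.
Proof. exact: row_mxKr. Qed.

Lemma A1_mkE8 (a b c d e f g h : R) :
  A1 (mkE8 a b c d e f g h) = mkE8 (- h) g (- f) e (- d) c (- b) a.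
Proof.
rewrite /A1 lsubmx_mkE8 rsubmx_mkE8 /qk !qmul_mkquat /mkE8.
by congr (row_mx (mkquat _ _ _ _) (mkquat _ _ _ _)); ring.
Qed.

Lemma A2_mkE8 (a b c d e f g h : R) :
  A2 (mkE8 a b c d e f g h) = mkE8 (- g) (- h) e f (- c) (- d) a b.
Proof.
rewrite /A2 lsubmx_mkE8 rsubmx_mkE8 /qj !qmul_mkquat /mkE8.
by congr (row_mx (mkquat _ _ _ _) (mkquat _ _ _ _)); ring.
Qed.

Lemma A3_mkE8 (a b c d e f g h : R) :
  A3 (mkE8 a b c d e f g h) = mkE8 f (- e) (- h) g b (- a) (- d) c.
Proof.
rewrite /A3 lsubmx_mkE8 rsubmx_mkE8 /qi !qmul_mkquat !mkquatN /mkE8.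
by congr (row_mx (mkquat _ _ _ _) (mkquat _ _ _ _)); ring.
Qed.

Lemma A4_mkE8 (a b c d e f g h : R) :
  A4 (mkE8 a b c d e f g h) = mkE8 e f g h (- a) (- b) (- c) (- d).
Proof. by rewrite /A4 lsubmx_mkE8 rsubmx_mkE8 mkquatN. Qed.

Lemma qrmul_mkE8 (a b c d e f g h : R) (z := mkE8 a b c d e f g h) :
  (qrmul z (qi R) = mkE8 (- b) a d (- c) (- f) e h (- g)) *
  (qrmul z (qj R) = mkE8 (- c) (- d) a b (- g) (- h) e f) *
  (qrmul z (qk R) = mkE8 (- d) c (- b) a (- h) g (- f) e).
Proof.
rewrite /z /qrmul lsubmx_mkE8 rsubmx_mkE8 /qi /qj /qk !qmul_mkquat /mkE8.
by do !split; congr (row_mx (mkquat _ _ _ _) (mkquat _ _ _ _)); ring.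
Qed.

Lemma A1_linear (a b : R) (x y : E) : A1 (a *: x + b *: y) = a *: A1 x + b *: A1 y.
Proof.
elim/mkE8_ind: x => *; elim/mkE8_ind: y => *.
by rewrite !(mkE8Z, mkE8D, A1_mkE8); congr mkE8; ring.
Qed.

Lemma A2_linear (a b : R) (x y : E) : A2 (a *: x + b *: y) = a *: A2 x + b *: A2 y.
Proof.
elim/mkE8_ind: x => *; elim/mkE8_ind: y => *.
by rewrite !(mkE8Z, mkE8D, A2_mkE8); congr mkE8; ring.
Qed.

Lemma dot_A1 (x y : E) : dot (A1 x) (A1 y) = dot x y.
Proof.
elim/mkE8_ind: x => *; elim/mkE8_ind: y => *.
rewrite !A1_mkE8 !dot_mkE8; ring.
Qed.

Lemma dot_A2 (x y : E) : dot (A2 x) (A2 y) = dot x y.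
Proof.
elim/mkE8_ind: x => *; elim/mkE8_ind: y => *.
rewrite !A2_mkE8 !dot_mkE8; ring.
Qed.

Lemma dot_A1A2 (x : E) : dot (A1 x) (A2 x) = 0.
Proof. elim/mkE8_ind: x => *; rewrite A1_mkE8 A2_mkE8 dot_mkE8; ring. Qed.

Lemma dot_xA1 (x : E) : dot x (A1 x) = 0.
Proof. elim/mkE8_ind: x => *; rewrite A1_mkE8 dot_mkE8; ring. Qed.

Lemma dot_xA2 (x : E) : dot x (A2 x) = 0.
Proof. elim/mkE8_ind: x => *; rewrite A2_mkE8 dot_mkE8; ring. Qed.

End Quaternions.

(** * Fatness of the quaternionic structure *)

Section QuaternionicFat.
Variable R : realType.
Local Notation E := (E8 R).

(** Right multiplication by an imaginary unit is skew-adjoint. The product of equations serves as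
    one multirule for [rewrite]. *)
Lemma dot_qrmul (u v : E) :
  (dot (qrmul u (qi R)) v = - dot u (qrmul v (qi R))) *
  (dot (qrmul u (qj R)) v = - dot u (qrmul v (qj R))) *
  (dot (qrmul u (qk R)) v = - dot u (qrmul v (qk R))).
Proof.
elim/mkE8_ind: u => *; elim/mkE8_ind: v => *.
by do !split; rewrite !qrmul_mkE8 !dot_mkE8; ring.
Qed.

Lemma qrmul_qrmul (u : E) :
  (qrmul (qrmul u (qi R)) (qi R) = - u) *
  (qrmul (qrmul u (qi R)) (qj R) = qrmul u (qk R)) *
  (qrmul (qrmul u (qi R)) (qk R) = - qrmul u (qj R)) *
  (qrmul (qrmul u (qj R)) (qi R) = - qrmul u (qk R)) *
  (qrmul (qrmul u (qj R)) (qj R) = - u) *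
  (qrmul (qrmul u (qj R)) (qk R) = qrmul u (qi R)) *
  (qrmul (qrmul u (qk R)) (qi R) = qrmul u (qj R)) *
  (qrmul (qrmul u (qk R)) (qj R) = - qrmul u (qi R)) *
  (qrmul (qrmul u (qk R)) (qk R) = - u).
Proof.
elim/mkE8_ind: u => *.
by do !split; rewrite !qrmul_mkE8 ?mkE8N ?opprK.
Qed.

Lemma dotNr (u v : E) : dot u (- v) = - dot u v.
Proof. by rewrite -scaleN1r dotZr mulN1r. Qed.

Lemma dotxqx (u : E) :
  (dot u (qrmul u (qi R)) = 0) * (dot u (qrmul u (qj R)) = 0) *
  (dot u (qrmul u (qk R)) = 0).
Proof.
elim/mkE8_ind: u => *.
by do !split; rewrite !qrmul_mkE8 !dot_mkE8; ring.
Qed.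

(** The rows span the right quaternionic line through [u], and are orthonormal when [u] is a unit
    vector. *)
Definition qline (u : E) : 'M[R]_(4, 4 + 4) :=
  \matrix_(i < 4) [:: u; qrmul u (qi R); qrmul u (qj R); qrmul u (qk R)]`_i.

(** The hypotheses say that the quaternionic Hermitian product of [u] and [v] is the real number
    [r]; skewness and the multiplication table reduce all sixteen entries to them. *)
Lemma qline_mul_tr (u v : E) (r : R) : dot u v = r ->
  dot u (qrmul v (qi R)) = 0 -> dot u (qrmul v (qj R)) = 0 ->
  dot u (qrmul v (qk R)) = 0 -> qline u *m (qline v)^T = r%:M.
Proof.
move=> uv ui uj uk; apply/matrixP => a b.
have -> : (qline u *m (qline v)^T) a b = dot (row a (qline u)) (row b (qline v)).
  by rewrite dotE !mxE; apply: eq_bigr => i _; rewrite !mxE.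
rewrite /qline !rowK !mxE.
by case: a b => [[|[|[|[|//]]]] ?] [[|[|[|[|//]]]] ?];
  rewrite /= ?dot_qrmul ?qrmul_qrmul ?dotNr ?uv ?ui ?uj ?uk
    ?opprK ?oppr0 ?mulr1n ?mulr0n.
Qed.

(** The quaternionic lines of [q] and [u] are orthogonal, hence together fill the whole space, and
    [w] is orthogonal to both. *)
Lemma HQ_fat (q u w : E) : dot q q = 1 -> dot u u = 1 ->
  HQ q u -> HQ q w -> dot w u = 0 ->
  dot w (qrmul u (qi R)) = 0 -> dot w (qrmul u (qj R)) = 0 ->
  dot w (qrmul u (qk R)) = 0 -> w = 0.
Proof.
move=> qq uu [uq uqi uqj uqk] [wq wqi wqj wqk] wu wui wuj wuk.
pose M := col_mx (qline q) (qline u).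
have M1 : M *m M^T = 1%:M.
  rewrite tr_col_mx mul_col_row !(qline_mul_tr qq) ?dotxqx //.
  rewrite (qline_mul_tr uu) ?dotxqx // (qline_mul_tr uq) //.
  rewrite (@qline_mul_tr q u 0) ?scalar_mx_block ?raddf0 //.
  - by rewrite dotC.
  - by rewrite dotC dot_qrmul uqi oppr0.
  - by rewrite dotC dot_qrmul uqj oppr0.
  - by rewrite dotC dot_qrmul uqk oppr0.
have wl (v : E) : dot w v = 0 -> dot w (qrmul v (qi R)) = 0 ->
    dot w (qrmul v (qj R)) = 0 -> dot w (qrmul v (qk R)) = 0 ->
    w *m (qline v)^T = 0.
  move=> w0 wi wj wk; apply/rowP => b; rewrite [RHS]mxE.
  have -> : (w *m (qline v)^T) 0 b = dot w (row b (qline v)).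
    by rewrite dotE !mxE; apply: eq_bigr => i _; rewrite !mxE.
  by rewrite /qline rowK; case: b => [[|[|[|[|//]]]] ?].
have wM : w *m M^T = 0 by rewrite tr_col_mx mul_mx_row !wl // row_mx0.
(* A right inverse of a square matrix is also a left inverse, so [w] equals [w *m M^T *m M]. *)
by rewrite -[w]mulmx1 -(mulmx1C M1) mulmxA wM mul0mx.
Qed.

End QuaternionicFat.

(** * The trivializable structure at the pole *)

Section Differentiability.
Variable R : realType.

(** The difference quotient is constant for nonzero [h], so the derivative is read off from an
    algebraic identity. *)
Lemma derive_affine (V W : normedModType R) (G : V -> W) (x v : V) (d : W) :
  (forall h : R, G (h *: v + x) = G x + h *: d) -> 'D_v G x = d.
Proof.
move=> GE; apply/lim_near_cst => //; near=> h; rewrite /= GE addrC addKr.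
rewrite scalerA mulVf ?scale1r //.
by near: h; exact: nbhs_dnbhs_neq.
Unshelve. all: by end_near. Qed.

Variable V : normedModType R.

Lemma differentiable_entry (m n : nat) (M : V -> 'M[R]_(m, n)) (x : V) i j :
  differentiable M x -> differentiable (fun y => M y i j) x.
Proof.
move=> dM; exact: (differentiable_comp dM (differentiable_coord (M x) i j)).
Qed.

Lemma differentiable_row n (M : V -> 'rV[R]_n) (x : V) :
  (forall j, differentiable (fun y => M y 0 j) x) -> differentiable M x.
Proof.
move=> dM.
have -> : M = \sum_(j < n) (fun y => M y 0 j *: delta_mx 0 j).
  by apply/funext => y; rewrite fct_sumE -row_sum_delta.
by apply: differentiable_sum => j; exact: differentiableZl.
Qed.

Lemma differentiable_mul_fun (f g : V -> R) (x : V) :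
  differentiable f x -> differentiable g x -> differentiable (fun y => f y * g y) x.
Proof. exact: differentiableM. Qed.

Lemma differentiable_add_fun (f g : V -> R) (x : V) :
  differentiable f x -> differentiable g x -> differentiable (fun y => f y + g y) x.
Proof. exact: differentiableD. Qed.

Lemma differentiable_opp_fun (f : V -> R) (x : V) :
  differentiable f x -> differentiable (fun y => - f y) x.
Proof. exact: differentiableN. Qed.

Lemma differentiable_qmul (f g : V -> quat R) (x : V) :
  differentiable f x -> differentiable g x ->
  differentiable (fun y => qmul (f y) (g y)) x.
Proof.
move=> df dg.
have dfe k : differentiable (fun y => f y 0 k) x by exact: differentiable_entry.
have dge k : differentiable (fun y => g y 0 k) x by exact: differentiable_entry.
apply: differentiable_row => -[[|[|[|[|//]]]] lt_j];
  under eq_fun => y do rewrite mxE /=;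
  do ?[apply: differentiable_add_fun | apply: differentiable_opp_fun
      | apply: differentiable_mul_fun | exact: dfe | exact: dge].
Qed.

Lemma differentiable_row_mx m n (f : V -> 'rV[R]_m) (g : V -> 'rV[R]_n) (x : V) :
  differentiable f x -> differentiable g x ->
  differentiable (fun y => row_mx (f y) (g y)) x.
Proof.
move=> df dg; apply: differentiable_row => j; rewrite -[j]fintype.splitK.
by case: (fintype.split j) => k /=; [under eq_fun => y do rewrite row_mxEl
  |under eq_fun => y do rewrite row_mxEr]; exact: differentiable_entry.
Qed.

End Differentiability.

(** * Conormal fields of [HT] and their curvature at (1, 0) *)

Section TrivializableFat.
Variable R : realType.
Local Notation E := (E8 R).

(* The fiber of HT at (x, y) consists of the vectors (y u, - x u^* ), u in H.  So
   (a, b) is orthogonal to it iff y^* a = b^* x; scaling by |x|^2 to avoid the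
   denominator, b = x a^* y, and a^* = - a as only imaginary a are used. *)
Definition conormal (c : quat R) (z : E) : E :=
  row_mx ((\sum_j lsubmx z 0 j ^+ 2) *: c) (- qmul (qmul (lsubmx z) c) (rsubmx z)).

Lemma conormal_mkE8 (a b c x0 x1 x2 x3 y0 y1 y2 y3 : R)
    (n := x0 ^+ 2 + x1 ^+ 2 + x2 ^+ 2 + x3 ^+ 2) :
  conormal (mkquat 0 a b c) (mkE8 x0 x1 x2 x3 y0 y1 y2 y3) =
  row_mx (n *: mkquat 0 a b c)
    (- qmul (qmul (mkquat x0 x1 x2 x3) (mkquat 0 a b c)) (mkquat y0 y1 y2 y3)).
Proof.
rewrite /conormal lsubmx_mkE8 rsubmx_mkE8; congr (row_mx (_ *: _) _).
by rewrite !big_ord_recl big_ord0 !mxE /n /= addr0 !addrA.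
Qed.

Lemma dot_HT_conormal (a b c : R) (z v : E) :
  HT z v -> dot v (conormal (mkquat 0 a b c) z) = 0.
Proof.
move=> [c1 [c2 [c3 [c4 ->]]]]; elim/mkE8_ind: z => *.
rewrite conormal_mkE8 A1_mkE8 A2_mkE8 A3_mkE8 A4_mkE8 !qmul_mkquat mkquatZ mkquatN.
rewrite !mkE8Z !mkE8D [X in dot _ X]/(mkE8 _ _ _ _ _ _ _ _) dot_mkE8; ring.
Qed.

Lemma differentiable_conormal (c : quat R) (z : E) : differentiable (conormal c) z.
Proof.
have dl : differentiable (fun y : E => lsubmx y) z by exact: differentiable_lsubmx.
have dr : differentiable (fun y : E => rsubmx y) z by exact: differentiable_rsubmx.
apply: differentiable_row_mx.
  apply: differentiableZl.
  have -> : (fun y : E => \sum_j lsubmx y 0 j ^+ 2) =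
      \sum_j (fun y : E => lsubmx y 0 j ^+ 2).
    by apply/funext => y; rewrite fct_sumE.
  apply: differentiable_sum => j; apply: differentiable_mul_fun;
    exact: differentiable_entry.
apply: differentiableN; apply: differentiable_qmul => //.
by apply: differentiable_qmul.
Qed.

Lemma HT_pole (v : E) : HT (mkE8 1 0 0 0 0 0 0 0) v ->
  exists e f g h, v = mkE8 0 0 0 0 e f g h.
Proof.
move=> [c1 [c2 [c3 [c4 ->]]]]; exists (- c4), (- c3), c2, c1.
rewrite A1_mkE8 A2_mkE8 A3_mkE8 A4_mkE8 !mkE8Z !mkE8D; congr mkE8; ring.
Qed.

(** These directions keep the first component equal to 1, and there the conormal field is
    [(c, - c y)], affine in [y]. *)
Lemma derive_conormal_pole (a b c e f g h : R) :
  'D_(mkE8 0 0 0 0 e f g h) (conormal (mkquat 0 a b c)) (mkE8 1 0 0 0 0 0 0 0) =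
  row_mx 0 (- qmul (mkquat 0 a b c) (mkquat e f g h)).
Proof.
apply: derive_affine => t; rewrite !(mkE8Z, mkE8D) !conormal_mkE8.
rewrite !qmul_mkquat !mkquatN scale_row_mx scaler0 add_row_mx !mkquatZ.
congr row_mx; first by rewrite [RHS]addr0; congr mkquat; ring.
by rewrite mkquatD; congr mkquat; ring.
Qed.

(** Left multiplication by an imaginary quaternion is skew, so the symmetry hypothesis makes [u]
    orthogonal to the products of i, j, k with [v]. Together with [dot u v = 0] this kills the
    quaternion product of [u] and the conjugate of [v], whose norm is multiplicative. *)
Lemma HT_pole_fat (u v : E) (q := mkE8 1 0 0 0 0 0 0 0) :
  HT q u -> HT q v -> dot u v = 0 ->
  (forall a b c, dot u ('D_v (conormal (mkquat 0 a b c)) q) =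
                 dot v ('D_u (conormal (mkquat 0 a b c)) q)) ->
  dot u u * dot v v = 0.
Proof.
rewrite {}/q => /HT_pole[e [f [g [h ->]]]] /HT_pole[e' [f' [g' [h' ->]]]].
rewrite !dot_mkE8 => uv sym.
have := sym 0 0 1; have := sym 0 1 0; have := sym 1 0 0.
rewrite !derive_conormal_pole !qmul_mkquat !mkquatN.
have -> : 0 = mkquat 0 0 0 0 :> quat R.
  by apply/rowP; case=> [[|[|[|[|//]]]] ?]; rewrite !mxE.
rewrite -!/(mkE8 _ _ _ _ _ _ _ _) !dot_mkE8 => Hi Hj Hk.
(* Up to sign, these are the four components of the product of [u] with the conjugate of [v]. *)
have P0 : e * e' + f * f' + g * g' + h * h' = 0 by lra.
have P1 : e * f' - f * e' + g * h' - h * g' = 0 by lra.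
have P2 : e * g' - f * h' - g * e' + h * f' = 0 by lra.
have P3 : e * h' + f * g' - g * f' - h * e' = 0 by lra.
(* Euler's four-square identity *)
transitivity ((e * e' + f * f' + g * g' + h * h') ^+ 2
  + (e * f' - f * e' + g * h' - h * g') ^+ 2
  + (e * g' - f * h' - g * e' + h * f') ^+ 2
  + (e * h' + f * g' - g * f' - h * e') ^+ 2); first by ring.
by rewrite P0 P1 P2 P3 !expr0n !addr0.
Qed.

End TrivializableFat.

(** * The diagonal point *)

Section Diagonal.
Variable R : realType.
Local Notation E := (E8 R).

Definition diagonal_point : E :=
  mkE8 (Num.sqrt 2^-1) 0 0 0 (Num.sqrt 2^-1) 0 0 0.
Local Notation p := diagonal_point.

Lemma dot_diagonal : dot p p = 1.
Proof.
have := @sqr_sqrtr R 2^-1; rewrite invr_ge0 ler0n => /(_ isT) s2.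
rewrite dot_mkE8; lra.
Qed.

(** [A1] and [A2] both exchange the two factors, so their composite sends (x, y) to (x i, y i)
    without an exchange. [A3] gives (- y i, - x i), which is the opposite where x = y. *)
Lemma A1A2_diagonal : A1 (A2 p) = - A3 p.
Proof. by rewrite A2_mkE8 A1_mkE8 A3_mkE8 mkE8N !(oppr0, opprK). Qed.

Lemma A2A1_diagonal : A2 (A1 p) = A3 p.
Proof. by rewrite A1_mkE8 A2_mkE8 A3_mkE8 !(oppr0, opprK). Qed.

Lemma HT_A1 (z : E) : HT z (A1 z).
Proof. by exists 1, 0, 0, 0; rewrite scale1r !scale0r !addr0. Qed.

Lemma HT_A2 (z : E) : HT z (A2 z).
Proof. by exists 0, 1, 0, 0; rewrite scale1r !scale0r !addr0 add0r. Qed.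

Lemma HT_A3 (z : E) : HT z (A3 z).
Proof. by exists 0, 0, 1, 0; rewrite scale1r !scale0r !addr0 !add0r. Qed.

Lemma HT_oppA3 (z : E) : HT z (- A3 z).
Proof. by exists 0, 0, (-1), 0; rewrite scaleN1r !scale0r !addr0 !add0r. Qed.

Lemma differentiable_qrmul (c : quat R) (z : E) : differentiable (fun y : E => qrmul y c) z.
Proof.
apply: differentiable_row_mx; apply: differentiable_qmul.
- exact: differentiable_lsubmx.
- exact: differentiable_cst.
- exact: differentiable_rsubmx.
- exact: differentiable_cst.
Qed.

Lemma derive_qrmul (c : quat R) (z v : E) : 'D_v (fun y : E => qrmul y c) z = qrmul v c.
Proof.
apply: derive_affine => t; rewrite [c]mkquatK.
elim/mkE8_ind: z => *; elim/mkE8_ind: v => *.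
rewrite mkE8Z mkE8D /qrmul !lsubmx_mkE8 !rsubmx_mkE8 !qmul_mkquat.
rewrite scale_row_mx add_row_mx !mkquatZ !mkquatD.
by congr (row_mx (mkquat _ _ _ _) (mkquat _ _ _ _)); ring.
Qed.

(** The target [H'] is left arbitrary so that one obstruction serves both claims: [w1] and [w2] are
    the images of [A1 p] and [A2 p]. *)
Lemma isometry_diagonal (H' : Defs.distribution R) (U V : set E) (f : E -> E) :
  subriemannian_isometry (@HT R) H' U V f -> open_in_sphere7 U -> U p ->
  exists w1 w2, [/\ dot w1 w1 = 1, dot w2 w2 = 1, dot w1 w2 = 0,
    H' (f p) w1 & H' (f p) w2] /\
    forall nu : E -> E, differentiable nu (f p) ->
      (forall z v, H' z v -> dot v (nu z) = 0) ->
      dot w1 ('D_w2 nu (f p)) = dot w2 ('D_w1 nu (f p)).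
Proof.
move=> [[sf _] isof] [B oB UE] Up.
have [F [W [oW Wp sF FE]]] := sf p Up.
(* The extension [F] at [p] is also one at every point of [U] in [W], so the isometry conditions
   hold throughout a neighbourhood and can be differentiated. *)
have isoF z : W z -> U z -> (forall v, HT z v -> H' (f z) ('D_v F z)) /\
    (forall v w, HT z v -> HT z w -> dot ('D_v F z) ('D_w F z) = dot v w).
  by move=> Wz Uz; apply: isof => //; exists W; split.
have [HF dF] := isoF p Wp Up.
have Fp : F p = f p by exact: FE.
have Bp : B p by move: Up; rewrite UE => -[].
have pp := dot_diagonal.
exists ('D_(A1 p) F p), ('D_(A2 p) F p); split.
  split; [|  |  |exact: HF _ (HT_A1 p)|exact: HF _ (HT_A2 p)].
  - by rewrite (dF _ _ (HT_A1 p) (HT_A1 p)) dot_A1.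
  - by rewrite (dF _ _ (HT_A2 p) (HT_A2 p)) dot_A2.
  - by rewrite (dF _ _ (HT_A1 p) (HT_A2 p)) dot_A1A2.
move=> nu dnu ann.
have annF z v : W z -> B z -> sphere7 z -> HT z v -> dot ('D_v F z) (nu (F z)) = 0.
  move=> Wz Bz Sz Hv; have Uz : U z by rewrite UE; split.
  by rewrite (FE z Wz Uz); apply: ann; exact: (isoF z Wz Uz).1.
have dnuF : differentiable nu (F p) by rewrite Fp.
(* [E1] differentiates the pairing for [A1] along [A2 p], and [E2] the one for [A2] along [A1 p]. *)
have E1 := pullback_derivative oW Wp sF oB Bp (@A1_linear R) pp
  (etrans (dot_A2 p p) pp) (dot_xA2 p) dnuF
  (fun z Wz Bz Sz => annF z _ Wz Bz Sz (HT_A1 z)).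
have E2 := pullback_derivative oW Wp sF oB Bp (@A2_linear R) pp
  (etrans (dot_A1 p p) pp) (dot_xA1 p) dnuF
  (fun z Wz Bz Sz => annF z _ Wz Bz Sz (HT_A2 z)).
rewrite dotDl A1A2_diagonal (annF _ _ Wp Bp pp (HT_oppA3 p)) addr0 in E1.
rewrite dotDl A2A1_diagonal (annF _ _ Wp Bp pp (HT_A3 p)) addr0 in E2.
(* The second derivatives of [F] in [E1] and [E2] agree and cancel, leaving the two derivatives of
   [nu]. *)
have S : 'D_(A1 p) ('D_(A2 p) F) p = 'D_(A2 p) ('D_(A1 p) F) p.
  apply: (derive_comm oW Wp _ (((sF 2%N _).2 _).2 _ Wp) (((sF 2%N _).2 _).2 _ Wp)) => x Wx.
  by split; [exact: (sF 1%N _).1|exact: (sF 1%N _).1|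
    exact: ((sF 2%N _).2 _).1|exact: ((sF 2%N _).2 _).1].
rewrite S in E1; rewrite -Fp.
by have /addrI := etrans E1 (esym E2).
Qed.

End Diagonal.

(** * The obstruction at the diagonal point against both targets *)

Theorem theorem6p4 (R : realType) :
  ~ locally_isometric (@HQ R) (@HT R) /\
  ~ acts_transitively_on_sphere7 (isometry_group (@HT R)).
Proof.
have Sp : sphere7 (diagonal_point R) by exact: dot_diagonal.
split.
- move=> [_ /(_ _ Sp)[U [V [f [oU Up [B _ VE] iso]]]]].
  have [w1 [w2 [[w11 w22 w12 Hw1 Hw2] sym]]] := isometry_diagonal iso oU Up.
  have fS : dot (f (diagonal_point R)) (f (diagonal_point R)) = 1.
    have [[_ [g [_ [fUV _ _ _]]]] _] := iso.
    by have := fUV _ Up; rewrite VE => -[].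
  (* The linear field [qrmul z c], for [c] an imaginary unit, is conormal to [HQ] and is its own
     derivative. *)
  have symq (c : quat R) : (forall z v : E8 R, HQ z v -> dot v (qrmul z c) = 0) ->
      dot w1 (qrmul w2 c) = dot w2 (qrmul w1 c).
    by move=> ann; have := sym _ (differentiable_qrmul c _) ann; rewrite !derive_qrmul.
  (* Symmetry and skewness together make the pairing equal to its own opposite. *)
  have w2q (c : quat R) :
     (forall z v : E8 R, HQ z v -> dot v (qrmul z c) = 0) ->
     (forall u v : E8 R, dot (qrmul u c) v = - dot u (qrmul v c)) ->
     dot w2 (qrmul w1 c) = 0.
    by move=> ann skew; have := symq c ann; have := skew w2 w1;
       rewrite [dot w1 _]dotC; lra.
  have w20 : w2 = 0.
    apply: (HQ_fat fS w11 Hw1 Hw2); first by rewrite dotC.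
    + by apply: w2q => [z v []|u v]; rewrite ?dot_qrmul.
    + by apply: w2q => [z v []|u v]; rewrite ?dot_qrmul.
    + by apply: w2q => [z v []|u v]; rewrite ?dot_qrmul.
  by move/eqP: w22; rewrite w20 -(scale0r (0 : E8 R)) dotZl mul0r eq_sym oner_eq0.
- have Sq : sphere7 (mkE8 1 0 0 0 0 0 0 0 : E8 R).
    by rewrite /sphere7 /= dot_mkE8; ring.
  (* Transitivity would move the diagonal point, where [HT] is not fat, to (1, 0), where it is. *)
  move=> /(_ _ _ Sp Sq)[f iso fp].
  have oS : open_in_sphere7 (@sphere7 R).
    by exists setT; [exact: openT|rewrite setIT].
  have [w1 [w2 [[w11 w22 w12 Hw1 Hw2] sym]]] := isometry_diagonal iso oS Sp.
  rewrite fp in Hw1 Hw2 sym.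
  have := HT_pole_fat Hw1 Hw2 w12 (fun a b c =>
    sym _ (differentiable_conormal _ _) (@dot_HT_conormal _ a b c)).
  by rewrite w11 w22 mul1r => /eqP; rewrite oner_eq0.
Qed.
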